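(* Consider the linear regression model $y=X\theta+u$ (context). Suppose that for a given $i\ge1$ with $i\le k=k(n)$ for all large enough $n$ we have $\xi_{i,n}\eta_{i,n}\to0$. Let $a_{i,n}$ be any sequence of non-negative reals, $E_{S,i,n}=[\tilde\theta_{S,i}-\hat\sigma a_{i,n},\tilde\theta_{S,i}+\hat\sigma a_{i,n}]$ and $C_{S,i,n}=[\hat\theta_{S,i}-\sigma a_{i,n},\hat\theta_{S,i}+\sigma a_{i,n}]$. Then, for any $\sigma>0$, $$\inf_{\theta\in\mathbb{R}^k,\sigma'\in(0,\infty)}P_{n,\theta,\sigma'}(\theta_i\in E_{S,i,n})-\inf_{\theta\in\mathbb{R}^k}P_{n,\theta,\sigma}(\theta_i\in C_{S,i,n})\longrightarrow0$$ as $n-k\to\infty$.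
   Context: Model: for each $n$, $y=X\theta+u$ with $y\in\mathbb{R}^n$, $X$ a non-stochastic $n\times k$ matrix of rank $k\ge1$ ($k=k(n)$ and all entries may depend on $n$), $\theta\in\mathbb{R}^k$, $u\sim N(0,\sigma^2I_n)$, $\sigma>0$. $P_{n,\theta,\sigma}$ is the probability under $(\theta,\sigma)$. $\hat\theta_{LS}=(X'X)^{-1}X'y$, $\hat\sigma^2=(y-X\hat\theta_{LS})'(y-X\hat\theta_{LS})/(n-k)$ (for $n>k$), $\xi_{i,n}\ge0$ with $\xi_{i,n}^2=((X'X/n)^{-1})_{ii}$. Standing assumption for asymptotic results: $\sup_n\xi_{i,n}^2/n<\infty$. Tuning parameters $\eta_{i,n}>0$. Soft-thresholding: known-variance $\hat\theta_{S,i}=\operatorname{sgn}(\hat\theta_{LS,i})(|\hat\theta_{LS,i}|-\sigma\xi_{i,n}\eta_{i,n})_+$, feasible $\tilde\theta_{S,i}=\operatorname{sgn}(\hat\theta_{LS,i})(|\hat\theta_{LS,i}|-\hat\sigma\xi_{i,n}\eta_{i,n})_+$. *)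

(* Defs.v *)
From HB Require Import structures.
From mathcomp Require Import all_boot all_order all_algebra.
From mathcomp Require Import all_classical all_reals all_analysis.
Set Implicit Arguments. Unset Strict Implicit. Unset Printing Implicit Defensive.
Import Order.TTheory GRing.Theory Num.Theory.
Local Open Scope classical_set_scope.
Local Open Scope ring_scope.

Section Regression.
Context {R : realType}.

(* i-th coordinate (0-based, as a nat) of a column vector; 0 if out of range *)
Definition vcoord {k : nat} (v : 'cV[R]_k) (i : nat) : R :=
  if insub i is Some j then v j 0 else 0.

Definition mdiag {k : nat} (A : 'M[R]_k) (i : nat) : R :=
  if insub i is Some j then A j j else 0.

Definition theta_LS {n k : nat} (X : 'M[R]_(n, k)) (y : 'cV[R]_n) : 'cV[R]_k :=
  invmx (X^T *m X) *m (X^T *m y).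

Definition sigma_hat {n k : nat} (X : 'M[R]_(n, k)) (y : 'cV[R]_n) : R :=
  let r := y - X *m theta_LS X y in
  Num.sqrt ((r^T *m r) 0 0 / (n - k)%:R).

Definition xi {n k : nat} (X : 'M[R]_(n, k)) (i : nat) : R :=
  Num.sqrt (mdiag (invmx ((n%:R)^-1 *: (X^T *m X))) i).

Definition soft (b t : R) : R := Num.sg b * Num.max (`|b| - t) 0.

Definition theta_S {n k : nat} (X : 'M[R]_(n, k)) (y : 'cV[R]_n)
  (sigma eta : R) (i : nat) : R :=
  soft (vcoord (theta_LS X y) i) (sigma * xi X i * eta).

Definition theta_S_feas {n k : nat} (X : 'M[R]_(n, k)) (y : 'cV[R]_n)
  (eta : R) (i : nat) : R :=
  soft (vcoord (theta_LS X y) i) (sigma_hat X y * xi X i * eta).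

Definition iid_std_normal {d : measure_display} {Omega : measurableType d}
  (P : probability Omega R) (Z : nat -> Omega -> R) : Prop :=
  [/\ (forall j, measurable_fun setT (Z j)),
      (forall j (B : set R), measurable B ->
          P (Z j @^-1` B) = normal_prob 0 1 B) &
      (forall (I : seq nat) (B : nat -> set R), uniq I ->
          (forall j, measurable (B j)) ->
          P (\bigcap_(j in [set` I]) (Z j @^-1` B j)) =
          (\prod_(j <- I) P (Z j @^-1` B j))%E)].

(* error vector u = sigma * (Z_0, ..., Z_{n-1})' ~ N(0, sigma^2 I_n) *)
Definition noise {d : measure_display} {Omega : measurableType d}
  (Z : nat -> Omega -> R) (n : nat) (sigma : R) (w : Omega) : 'cV[R]_n :=
  sigma *: \col_(j < n) Z j w.

Definition obs {d : measure_display} {Omega : measurableType d}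
  (Z : nat -> Omega -> R) {n k : nat} (X : 'M[R]_(n, k)) (theta : 'cV[R]_k)
  (sigma : R) (w : Omega) : 'cV[R]_n :=
  X *m theta + noise Z n sigma w.

Definition covE {d : measure_display} {Omega : measurableType d}
  (P : probability Omega R) (Z : nat -> Omega -> R) {n k : nat}
  (X : 'M[R]_(n, k)) (eta a : R) (i : nat) (theta : 'cV[R]_k) (sigma : R)
  : \bar R :=
  P [set w | let y := obs Z X theta sigma w in
             theta_S_feas X y eta i - sigma_hat X y * a <= vcoord theta i
             <= theta_S_feas X y eta i + sigma_hat X y * a].

Definition covC {d : measure_display} {Omega : measurableType d}
  (P : probability Omega R) (Z : nat -> Omega -> R) {n k : nat}
  (X : 'M[R]_(n, k)) (eta a : R) (i : nat) (theta : 'cV[R]_k) (sigma : R)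
  : \bar R :=
  P [set w | let y := obs Z X theta sigma w in
             theta_S X y sigma eta i - sigma * a <= vcoord theta i
             <= theta_S X y sigma eta i + sigma * a].

Definition infE {d : measure_display} {Omega : measurableType d}
  (P : probability Omega R) (Z : nat -> Omega -> R) {n k : nat}
  (X : 'M[R]_(n, k)) (eta a : R) (i : nat) : \bar R :=
  ereal_inf [set p | exists (theta : 'cV[R]_k) (s' : R),
                       0 < s' /\ p = covE P Z X eta a i theta s'].

Definition infC {d : measure_display} {Omega : measurableType d}
  (P : probability Omega R) (Z : nat -> Omega -> R) {n k : nat}
  (X : 'M[R]_(n, k)) (eta a : R) (i : nat) (sigma : R) : \bar R :=
  ereal_inf [set p | exists theta : 'cV[R]_k, p = covC P Z X eta a i theta sigma].

End Regression.

(* Main.v *)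
(* Let V = (theta_LS_i - theta_i) / sigma, s = sigma_hat / sigma and t = xi eta;
   the joint law of (V, s) does not depend on (theta, sigma).  If theta_i >= 0
   (resp. <= 0), the event that the interval around the soft-thresholding
   estimator covers theta_i contains |V - s t| <= s a (resp. |V + s t| <= s a),
   and equals it as soon as |theta_i| > s sigma a; for known variance, s is
   replaced by 1.  Hence each infimum is, up to P(|s - 1| > e), the minimum of
   two interval probabilities.  Replacing s by 1 in these intervals changes
   their probability by at most P(|s - 1| > e) plus the probability that V lies
   within e |x| of an end point x; both are small uniformly in all parameters.
   The two bounds follow by Markov's inequality from the exact expectation of
   exponentials of quadratic functions of the errors, computed by integrating
   out one Gaussian coordinate at a time: for quadratic forms this is the Schur
   complement recursion for the determinant. *)
Require Import Defs.
From HB Require Import structures.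
From mathcomp Require Import all_boot all_order all_algebra.
From mathcomp Require Import all_classical all_reals all_analysis.
From mathcomp Require Import measurable_realfun ring lra.
Set Implicit Arguments. Unset Strict Implicit. Unset Printing Implicit Defensive.
Import Order.TTheory GRing.Theory Num.Theory.
Import numFieldNormedType.Exports.
Local Open Scope classical_set_scope.
Local Open Scope ring_scope.

(** * Measure-theoretic preliminaries and one-dimensional Gaussian integrals *)

Lemma measurable_set_le (R : realType) (d : measure_display)
    (T : measurableType d) (f g : T -> R) :
  measurable_fun setT f -> measurable_fun setT g ->
  measurable [set w | f w <= g w].
Proof.
move=> mf mg; rewrite -[X in measurable X]setTI.
exact: (measurable_fun_ler mf mg measurableT (Y := [set true])).
Qed.

(** The Radon-Nikodym derivative of the normal law and its density have the same integral over every
    measurable set, hence agree almost everywhere. *)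
Lemma ge0_integral_normal_prob (R : realType) (m s : R) (f : R -> \bar R) :
  measurable_fun setT f -> (forall x, 0 <= f x)%E ->
  (\int[normal_prob m s]_x f x =
   \int[lebesgue_measure]_x (f x * (normal_pdf m s x)%:E))%E.
Proof.
move=> mf f0.
have dom := normal_prob_dominates m s.
rewrite -(Radon_Nikodym_SigmaFinite.change_of_variables dom)//.
have mg : measurable_fun setT (Radon_Nikodym_SigmaFinite.f
    (normal_prob m s) (@lebesgue_measure R)).
  by apply: measurable_int (Radon_Nikodym_SigmaFinite.f_integrable dom).
apply: ae_eq_integral => //.
- exact: emeasurable_funM.
- apply: emeasurable_funM => //; apply/measurable_EFinP.
  exact: measurable_normal_pdf.
- apply: ae_eqe_mul2l; apply: integral_ae_eq => //.
  + exact: Radon_Nikodym_SigmaFinite.f_integrable.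
  + by apply/measurable_EFinP; exact: measurable_normal_pdf.
  + by move=> E _ mE; rewrite -Radon_Nikodym_SigmaFinite.f_integral.
Qed.

(* Completing the square. *)
Lemma integral_normal_prob_expR_quad (R : realType) (a b : R) : 0 < 1 + a ->
  (\int[normal_prob 0 1]_z (expR (- ((a * z ^+ 2 + b * z *+ 2) / 2)))%:E =
   ((Num.sqrt (1 + a))^-1 * expR (b ^+ 2 / (1 + a) / 2))%:E)%E.
Proof.
move=> a1.
rewrite ge0_integral_normal_prob/=; last 2 first.
- apply/measurable_EFinP/measurableT_comp => //.
  apply: measurable_funN; apply: measurable_funM => //.
  apply: measurable_funD.
    by apply: measurable_funM => //; exact: measurable_funX.
  rewrite (_ : (fun _ => _) = (fun x => b * 2 * x)); last first.
    by apply/funext => x; ring.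
  exact: measurable_funM.
- by move=> x; rewrite lee_fin expR_ge0.
(* The integrand times the standard density is a multiple of the density with mean [m] and standard
   deviation [s]. *)
set s := (Num.sqrt (1 + a))^-1; set m := - b / (1 + a).
have s0 : 0 < s by rewrite invr_gt0 sqrtr_gt0.
have s2 : s ^+ 2 = (1 + a)^-1 by rewrite exprVn sqr_sqrtr// ltW.
transitivity (\int[lebesgue_measure]_x
   ((s * expR (b ^+ 2 / (1 + a) / 2))%:E * (normal_pdf m s x)%:E))%E.
  apply: eq_integral => z _; rewrite -!EFinM; congr EFin.
  rewrite !normal_pdfE ?oner_neq0 ?gt_eqF// /normal_peak/normal_fun.
  have peakE (t : R) : 0 < t ->
      Num.sqrt (t ^+ 2 * pi *+ 2) = t * Num.sqrt (pi *+ 2).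
    by move=> t0; rewrite -mulrnAr sqrtrM ?sqr_ge0// sqrtr_sqr gtr0_norm.
  rewrite !peakE// mul1r subr0 expr1n.
  rewrite mulrCA -expRD mulrACA invfM [s * _]mulrA divff ?gt_eqF// mul1r.
  rewrite -expRD s2 /m; congr (_ * expR _).
  have : 1 + a != 0 by rewrite gt_eqF.
  by move=> ?; field.
rewrite ge0_integralZl//=.
- by rewrite integral_normal_pdf mule1.
- by apply/measurable_EFinP; exact: measurable_normal_pdf.
- by move=> x _; rewrite lee_fin normal_pdf_ge0.
- by rewrite lee_fin mulr_ge0 ?expR_ge0// ltW.
Qed.

(** Taking [A] to be everything shows that [Q] is the law of [Y]. Rectangles determine the joint law
    as a product measure, and Tonelli's theorem gives the iterated integral. *)
Lemma ge0_integral_indep (R : realType) (d d1 d2 : measure_display)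
    (Omega : measurableType d) (T1 : measurableType d1) (T2 : measurableType d2)
    (P : probability Omega R) (Q : probability T2 R) (X : Omega -> T1)
    (Y : Omega -> T2) (F : T1 * T2 -> \bar R) :
  measurable_fun setT X -> measurable_fun setT Y ->
  (forall A B, measurable A -> measurable B ->
     P (X @^-1` A `&` Y @^-1` B) = P (X @^-1` A) * Q B)%E ->
  measurable_fun setT F -> (forall x, 0 <= F x)%E ->
  (\int[P]_w F (X w, Y w) = \int[P]_w \int[Q]_z F (X w, z))%E.
Proof.
move=> mX mY PXY mF F0.
pose X' : {RV P >-> T1} := HB.pack X (isMeasurableFun.Build _ _ _ _ X mX).
have mXY : measurable_fun setT (fun w => (X w, Y w)).
  exact: measurable_fun_pair.
pose XY : {RV P >-> (T1 * T2)%type} := HB.pack (fun w => (X w, Y w))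
  (isMeasurableFun.Build _ _ _ _ _ mXY).
rewrite -(ge0_integral_distribution XY)//.
have mG : measurable_fun setT (fubini_F Q F).
  exact: measurable_fun_fubini_tonelli_F.
rewrite -(ge0_integral_distribution X' mG); last first.
  by move=> y; apply: integral_ge0 => z _.
rewrite -fubini_tonelli1//; apply: eq_measure_integral => A mA _.
apply/esym/(product_measure_unique (m' := distribution P XY)) => //.
Qed.

(** * Independence of one Gaussian coordinate from all the others *)

Section Independence.
Context (R : realType) (d : measure_display) (Omega : measurableType d).
Variables (P : probability Omega R) (Z : nat -> Omega -> R).
Hypothesis HZ : iid_std_normal P Z.

(** Generates the sigma-algebra of all coordinates except the [l]-th. Finite intersections make it a
    pi-system and fit the product rule in [iid_std_normal]. *)
Definition cylinders_off (l : nat) : set (set Omega) :=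
  [set A | exists I (B : nat -> set R), [/\ uniq I, l \notin I,
     (forall j, measurable (B j)) &
     A = \bigcap_(j in [set` I]) (Z j @^-1` B j)]].

Let mZ j : measurable_fun setT (Z j). Proof. by have [] := HZ. Qed.

Let mZpre j (B : set R) : measurable B -> measurable (Z j @^-1` B).
Proof. by move=> mB; rewrite -[X in measurable X]setTI; exact: mZ. Qed.

Lemma cylinders_off_setI l : setI_closed (cylinders_off l).
Proof.
move=> _ _ [I [B [uI lI mB ->]]] [J [C [uJ lJ mC ->]]].
(* A common index is kept once, with both constraints; an index missing from one list is constrained
   by [setT] there. *)
exists (undup (I ++ J)),
  (fun j => (if j \in I then B j else setT) `&`
            (if j \in J then C j else setT)).
split.
- exact: undup_uniq.
- by rewrite mem_undup mem_cat negb_or lI.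
- by move=> j; apply: measurableI; case: ifP.
- apply/seteqP; split=> w /=.
    move=> [wI wJ] j /=; rewrite mem_undup mem_cat => _.
    by split; case: ifPn => // jI; [exact: wI|exact: wJ].
  move=> wIJ; split=> j /= jI.
    have := wIJ j; rewrite /= mem_undup mem_cat jI => /(_ isT)[+ _].
    exact.
  have := wIJ j; rewrite /= mem_undup mem_cat jI orbT => /(_ isT)[_ +].
  exact.
Qed.

Lemma cylinders_offT l : cylinders_off l setT.
Proof.
exists [::], (fun=> setT); split => //.
by apply/seteqP; split.
Qed.

Lemma cylinders_off_measurable l : cylinders_off l `<=` measurable.
Proof.
move=> _ [I [B [_ _ mB ->]]]; apply: fin_bigcap_measurable => //.
by move=> j _; exact: mZpre.
Qed.

Lemma sigma_off_measurable l : <<s cylinders_off l >> `<=` measurable.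
Proof.
apply: smallest_sub; first exact: sigma_algebra_measurable.
exact: cylinders_off_measurable.
Qed.

(** As functions of [A], both sides are finite measures that agree on the pi-system of cylinders,
    hence on the sigma-algebra it generates. *)
Lemma sigma_off_indep l A (B : set R) : <<s cylinders_off l >> A ->
  measurable B -> P (A `&` Z l @^-1` B) = (P A * normal_prob 0 1 B)%E.
Proof.
move=> sA mB; have [_ Zn Zi] := HZ.
have p0 : 0 <= fine (normal_prob 0 1 B) by rewrite fine_ge0.
have fB : normal_prob 0 1 B \is a fin_num by exact: fin_num_measure.
have scaleE C : mscale (NngNum p0) P C = (P C * normal_prob 0 1 B)%E.
  by rewrite /mscale /= [X in (X * _)%E]fineK// muleC.
rewrite -scaleE.
change (mrestr P (mZpre l mB) A = mscale (NngNum p0) P A).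
apply: (g_sigma_algebra_measure_unique (cylinders_off l) _ (fun=> setT)) => //.
- exact: cylinders_off_measurable.
- by move=> _; exact: cylinders_offT.
- by rewrite bigcup_const//; exists 0%N.
- exact: cylinders_off_setI.
- move=> C [I [D [uI lI mD ->]]].
  rewrite [RHS]scaleE.
  change (P ((\bigcap_(j in [set` I]) (Z j @^-1` D j)) `&` Z l @^-1` B) =
    P (\bigcap_(j in [set` I]) (Z j @^-1` D j)) * normal_prob 0 1 B)%E.
  (* Since [l] is not in [I], placing [B] at index [l] makes the intersection a single cylinder. *)
  pose D' j := if j == l then B else D j.
  have DD' j : j \in I -> D' j = D j.
    by move=> jI; rewrite /D'; case: eqP jI lI => // -> ->.
  have -> : \bigcap_(j in [set` I]) (Z j @^-1` D j) `&` Z l @^-1` B =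
      \bigcap_(j in [set` l :: I]) (Z j @^-1` D' j).
    apply/seteqP; split => w /=.
      move=> [wI wl] j /=; rewrite inE => /orP[/eqP->|jI].
        by rewrite /D' eqxx.
      by rewrite DD'//; exact: wI.
    move=> H; split; last by have := H l; rewrite /= inE /D' eqxx => /(_ isT).
    by move=> j /= jI; have := H j; rewrite /= inE jI orbT DD'// => /(_ isT).
  rewrite !Zi//=; last 2 first.
  - by rewrite lI.
  - by move=> j; rewrite /D'; case: ifP.
  rewrite big_cons {1}/D' eqxx Zn//; rewrite muleC; congr (_ * _)%E.
  by apply: eq_big_seq => j jI; rewrite DD'.
- move=> k; change (P (setT `&` Z l @^-1` B) < +oo)%E.
  by rewrite setTI (le_lt_trans (probability_le1 _ _)) ?ltry//; exact: mZpre.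
Qed.

Lemma measurable_off l j : j != l ->
  measurable_fun setT (Z j : g_sigma_algebraType (cylinders_off l) -> R).
Proof.
move=> jl _ B mB; rewrite setTI; apply: sub_sigma_algebra.
exists [:: j], (fun=> B); split => //; first by rewrite inE eq_sym.
by apply/seteqP; split=> w /=; [move=> wB i /=; rewrite inE => /eqP->|
  move=> /(_ j); rewrite /= inE eqxx; exact].
Qed.

(** The identity of [Omega], as a map into the coarser sigma-algebra, is the variable independent of
    [Z l]; thus [F] may involve all other coordinates at once. *)
Lemma integral_off l
    (F : g_sigma_algebraType (cylinders_off l) * R -> \bar R) :
  measurable_fun setT F -> (forall x, 0 <= F x)%E ->
  (\int[P]_w F (w, Z l w) =
   \int[P]_w \int[normal_prob 0 1]_z F (w, z))%E.
Proof.
move=> mF F0.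
apply: (ge0_integral_indep
  (X := (id : Omega -> g_sigma_algebraType (cylinders_off l)))
  (Q := normal_prob 0 1)) => //.
- by move=> _ A sA; rewrite setTI; exact: (sigma_off_measurable sA).
- exact: mZ.
- by move=> A B sA mB; exact: sigma_off_indep.
Qed.
End Independence.

(** * Matrix products and Sylvester's determinant identity *)

Lemma measurable_mulmx (R : realType) (d : measure_display)
    (T : measurableType d) (m n p : nat)
    (A : T -> 'M[R]_(m, n)) (B : T -> 'M[R]_(n, p)) :
  (forall i j, measurable_fun setT (fun w => A w i j)) ->
  (forall i j, measurable_fun setT (fun w => B w i j)) ->
  forall i j, measurable_fun setT (fun w => (A w *m B w) i j).
Proof.
move=> mA mB i j; under eq_fun do rewrite mxE.
by apply: measurable_sum => l; exact: measurable_funM.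
Qed.

(** Two block triangular factorisations of the matrix with identity diagonal blocks and off-diagonal
    blocks [- V] and [U] have the same determinant. *)
Lemma det_add1_mulmxC (R : comRingType) (n k : nat)
    (U : 'M[R]_(n, k)) (V : 'M[R]_(k, n)) :
  \det (1%:M + U *m V) = \det (1%:M + V *m U).
Proof.
have : block_mx 1%:M 0 U 1%:M *m block_mx 1%:M (- V) 0 (1%:M + U *m V) =
       block_mx (1%:M + V *m U) (- V) 0 1%:M *m block_mx 1%:M 0 U 1%:M.
  rewrite !mulmx_block !(mul1mx, mulmx1, mul0mx, mulmx0, addr0, add0r).
  by rewrite mulmxN mulNmx addrK addrCA addNr addr0.
move/(congr1 (fun A => \det A)); rewrite !det_mulmx !det_lblock !det_ublock.
by rewrite !det1 !mul1r !mulr1.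
Qed.

(** * Positive definite quadratic forms and Schur complements *)

Section SchurComplement.
Context (R : realFieldType).

Definition posdef_mx n (B : 'M[R]_n) :=
  forall v : 'cV[R]_n, v != 0 -> 0 < (v^T *m B *m v) 0 0.

(** Splits off the coordinate to be integrated, in the shape taken by
    [integral_normal_prob_expR_quad]. *)
Lemma block_quadratic n (a : R) (b : 'rV[R]_n) (B : 'M[R]_n) (x : R)
    (v : 'cV[R]_n) :
  ((col_mx x%:M v)^T *m block_mx a%:M b b^T B *m col_mx x%:M v) 0 0 =
  a * x ^+ 2 + (b *m v) 0 0 * x *+ 2 + (v^T *m B *m v) 0 0.
Proof.
rewrite tr_col_mx -mulmxA mul_block_col mul_row_col !mulmxDr !tr_scalar_mx.
have -> : v^T *m (b^T *m x%:M) = (x%:M *m (b *m v))^T.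
  by rewrite !trmx_mul tr_scalar_mx mulmxA.
rewrite !mul_scalar_mx -mulmxA !mxE.
by rewrite eqxx mulr1n; ring.
Qed.

Lemma posdef_pivot n (a : R) (b : 'rV[R]_n) (B : 'M[R]_n) :
  posdef_mx (block_mx a%:M b b^T B) -> 0 < a.
Proof.
move=> /(_ (col_mx 1%:M 0)); rewrite block_quadratic !mulmx0 !mxE.
rewrite mul0r mul0rn expr1n mulr1 !addr0; apply.
by rewrite col_mx_eq0 negb_and oner_neq0.
Qed.

(** For fixed [v] the form is minimal at first coordinate [- (b *m v) 0 0 / a], and the minimum is
    the form of the Schur complement. *)
Lemma posdef_schur n (a : R) (b : 'rV[R]_n) (B : 'M[R]_n) :
  posdef_mx (block_mx a%:M b b^T B) -> posdef_mx (B - a^-1 *: (b^T *m b)).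
Proof.
move=> H; have a0 := posdef_pivot H; move=> v v0.
have := H (col_mx (- (b *m v) 0 0 / a)%:M v).
rewrite col_mx_eq0 negb_and v0 orbT block_quadratic => /(_ isT).
suff -> : (v^T *m (B - a^-1 *: (b^T *m b)) *m v) 0 0 =
  (v^T *m B *m v) 0 0 - (b *m v) 0 0 ^+ 2 / a.
  have a1 : a != 0 by rewrite gt_eqF.
  by congr (0 < _); field.
rewrite mulmxBr mulmxBl -scalemxAr -scalemxAl mulmxA -trmx_mul -mulmxA.
rewrite -[_ *m b *m v]mulmxA; set u := b *m v.
have uu : (u^T *m u) 0 0 = u 0 0 ^+ 2.
  by rewrite mxE big_ord1 [u^T _ _]mxE expr2.
by rewrite [LHS]mxE [X in _ + X]mxE [X in - X]mxE uu [a^-1 * _]mulrC.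
Qed.

Lemma det_schur n (a : R) (b : 'rV[R]_n) (B : 'M[R]_n) : a != 0 ->
  \det (block_mx a%:M b b^T B) = a * \det (B - a^-1 *: (b^T *m b)).
Proof.
move=> a0.
have -> : block_mx a%:M b b^T B =
    block_mx 1%:M 0 (a^-1 *: b^T) 1%:M *m
    block_mx a%:M b 0 (B - a^-1 *: (b^T *m b)).
  rewrite mulmx_block !(mul1mx, mul0mx, mulmx0, addr0).
  by rewrite mul_mx_scalar scalerA divff// scale1r -scalemxAl addrC subrK.
by rewrite det_mulmx det_lblock det_ublock !det1 !mul1r det_scalar1.
Qed.

End SchurComplement.

(** * The residual projection of least squares *)

Section ResidualMaker.
Context (R : realFieldType) (n k : nat) (X : 'M[R]_(n, k)).

Lemma gram_ge0 m (v : 'cV[R]_m) : 0 <= (v^T *m v) 0 0.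
Proof. by rewrite mxE sumr_ge0// => i _; rewrite mxE -expr2 sqr_ge0. Qed.

Lemma gram_eq0 m (v : 'cV[R]_m) : (v^T *m v) 0 0 = 0 -> v = 0.
Proof.
rewrite mxE => /eqP; rewrite psumr_eq0; last first.
  by move=> i _; rewrite mxE -expr2 sqr_ge0.
move=> /allP v0; apply/matrixP => i j; rewrite ord1 mxE.
have := v0 i; rewrite mem_index_enum mxE -expr2 sqrf_eq0.
by move=> /(_ isT) /eqP.
Qed.

(** If [w] annihilates the Gram matrix, then [X *m w^T] has norm zero, and full column rank forces
    [w] to vanish. *)
Lemma gram_unitmx : \rank X = k -> X^T *m X \in unitmx.
Proof.
move=> rX; rewrite -row_free_unit -kermx_eq0; apply/eqP/row_matrixP => i.
rewrite row0; set w := row i _.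
have w0 : w *m (X^T *m X) = 0.
  by apply/sub_kermxP; exact: row_sub.
have : (X *m w^T) = 0.
  apply: gram_eq0; rewrite trmx_mul trmxK -mulmxA [X^T *m _]mulmxA mulmxA w0.
  by rewrite mul0mx mxE.
move/(congr1 trmx); rewrite trmx_mul trmxK trmx0 => wX.
have fX : row_free X^T by rewrite /row_free mxrank_tr rX.
by apply: (row_free_inj fX); rewrite wX mul0mx.
Qed.

(** For an invertible Gram matrix, the orthogonal projection onto the complement of the column space
    of [X]. *)
Definition residual_mx : 'M[R]_n :=
  1%:M - X *m (invmx (X^T *m X) *m X^T).

Hypothesis uX : X^T *m X \in unitmx.

Lemma residual_mx_tr : residual_mx^T = residual_mx.
Proof.
by rewrite /residual_mx linearB /= trmx1 !trmx_mul trmxK trmx_inv trmx_mul trmxK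
  mulmxA.
Qed.

Lemma residual_mx_X : residual_mx *m X = 0.
Proof.
by rewrite mulmxBl mul1mx -mulmxA -[invmx _ *m _ *m _]mulmxA mulVmx// mulmx1
  subrr.
Qed.

Lemma residual_mx_idem : residual_mx *m residual_mx = residual_mx.
Proof.
by rewrite {2}/residual_mx mulmxBr mulmx1 [_ *m (X *m _)]mulmxA residual_mx_X
  mul0mx subr0.
Qed.

Lemma residual_quad (v : 'cV[R]_n) :
  (v^T *m residual_mx *m v) 0 0 =
  ((residual_mx *m v)^T *m (residual_mx *m v)) 0 0.
Proof.
by rewrite trmx_mul residual_mx_tr mulmxA
  -[v^T *m residual_mx *m residual_mx]mulmxA residual_mx_idem.
Qed.

(** By Pythagoras for [v = r + e], the form is [1 + t] times the squared norm of [r] plus the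
    squared norm of [e]. *)
Lemma posdef_add1_residual (t : R) : 0 < 1 + t ->
  posdef_mx (1%:M + t *: residual_mx).
Proof.
move=> t1 v v0; set r := residual_mx *m v; set e := v - r.
have re0 : r^T *m e = 0.
  rewrite /e mulmxBr /r trmx_mul residual_mx_tr mulmxA.
  by rewrite -[_ *m residual_mx *m residual_mx]mulmxA residual_mx_idem subrr.
have er0 : e^T *m r = 0 by rewrite -[r]trmxK -trmx_mul re0 trmx0.
have vre : v = r + e by rewrite /e addrCA subrr addr0.
have -> : (v^T *m (1%:M + t *: residual_mx) *m v) 0 0 =
    (1 + t) * (r^T *m r) 0 0 + (e^T *m e) 0 0.
  rewrite mulmxDr mulmx1 mulmxDl -scalemxAr -scalemxAl mxE.
  rewrite [X in _ + X]mxE residual_quad -/r.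
  have -> : v^T *m v = r^T *m r + e^T *m e.
    have -> : v^T = r^T + e^T by rewrite {1}vre linearD.
    by rewrite {1}vre mulmxDl !(mulmxDr _ r e) re0 er0 addr0 add0r.
  by rewrite [X in X + _]mxE; ring.
have r0 := gram_ge0 r; have e0 := gram_ge0 e.
have tr0 : 0 <= (1 + t) * (r^T *m r) 0 0 by rewrite mulr_ge0// ltW.
rewrite lt0r addr_ge0// andbT paddr_eq0// mulf_eq0 gt_eqF//=.
apply: contra v0 => /andP[/eqP/gram_eq0 r00 /eqP/gram_eq0 e00].
by rewrite vre r00 e00 addr0.
Qed.

(** Taking [1 + t] out of the matrix gives the power [n]; Sylvester's identity reduces the rest to a
    scalar [k] by [k] matrix, which removes the power [k]. *)
Lemma det_add1_residual (t : R) : (k <= n)%N -> 0 < 1 + t ->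
  \det (1%:M + t *: residual_mx) = (1 + t) ^+ (n - k).
Proof.
move=> kn t1; have t0 : 1 + t != 0 by rewrite gt_eqF.
have -> : 1%:M + t *: residual_mx =
    (1 + t) *: (1%:M + X *m ((- t / (1 + t)) *: (invmx (X^T *m X) *m X^T))).
  rewrite -scalemxAr /residual_mx scalerBr scalerDr scalerA mulrC divfK//.
  by rewrite scaleNr addrA scalerDl scale1r.
rewrite detZ det_add1_mulmxC -scalemxAl -mulmxA mulVmx//.
have -> : 1%:M + (- t / (1 + t)) *: 1%:M = (1 + t)^-1%:M :> 'M[R]_k.
  rewrite -[RHS]scalemx1 -[X in X + _]scale1r -scalerDl.
  by congr (_ *: _); field.
by rewrite det_scalar -{1}(subnK kn) exprD exprVn mulfK// expf_neq0.
Qed.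

End ResidualMaker.

(** * Exact expectations of exponentials of Gaussian linear and quadratic functions *)

Lemma integral_cst_probability (R : realType) (d : measure_display)
    (Omega : measurableType d) (P : probability Omega R) (r : R) :
  (\int[P]_w r%:E = r%:E)%E.
Proof.
rewrite integral_cst//; transitivity (r%:E * 1)%E; last by rewrite mule1.
by congr (_ * _)%E; exact: probability_setT.
Qed.

Section GaussianIntegrals.
Context (R : realType) (d : measure_display) (Omega : measurableType d).
Variables (P : probability Omega R) (Z : nat -> Omega -> R).
Hypothesis HZ : iid_std_normal P Z.

(** Integrating out the last coordinate reproduces the expression with [p] replaced by
    [p / (1 + p * c n ^+ 2)], hence an induction over all [p] and [y]. *)
Lemma integral_expR_linear (n : nat) (c : nat -> R) (p y : R) : 0 <= p ->
  let p1 := 1 + p * \sum_(j < n) c j ^+ 2 in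
  (\int[P]_w (expR (- (p * (y + \sum_(j < n) c j * Z j w) ^+ 2 / 2)))%:E =
   ((Num.sqrt p1)^-1 * expR (- (p / p1 * y ^+ 2 / 2)))%:E)%E.
Proof.
elim: n p y => [|n IH] p y p0 /=.
  under eq_integral do rewrite big_ord0 addr0.
  rewrite integral_cst_probability.
  by rewrite big_ord0 mulr0 addr0 sqrtr1 invr1 mul1r mulr1.
pose S w := \sum_(j < n) c j * Z j w.
under eq_integral do rewrite big_ord_recr /= addrA.
pose T := g_sigma_algebraType (cylinders_off Z n).
pose F (x : T * R) : \bar R :=
  (expR (- (p * (y + S x.1 + c n * x.2) ^+ 2 / 2)))%:E.
rewrite (integral_off (l := n) HZ (F := F)); last 2 first.
- apply/measurable_EFinP/measurableT_comp => //; apply: measurable_funN.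
  apply: measurable_funM => //; apply: measurable_funM => //.
  apply: measurable_funX; apply: measurable_funD; last first.
    by apply: measurable_funM => //; exact: measurable_snd.
  apply: measurable_funD => //.
  apply: (@measurableT_comp _ _ _ _ _ _ (S : T -> R));
    last exact: measurable_fst.
  apply: measurable_sum => j; apply: measurable_funM => //.
  by apply: measurable_off; rewrite ltn_eqF.
- by move=> x; rewrite lee_fin expR_ge0.
set q := 1 + p * c n ^+ 2.
have q0 : 0 < q by rewrite ltr_pwDl// mulr_ge0 ?sqr_ge0.
have q1 : q != 0 by rewrite gt_eqF.
transitivity (\int[P]_w ((Num.sqrt q)^-1%:E *
    (expR (- (p / q * (y + S w) ^+ 2 / 2)))%:E))%E.
  apply: eq_integral => w _; rewrite /F /=.
  set u := y + S w.
  under eq_integral => z _.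
    rewrite (_ : - _ = - (p * u ^+ 2 / 2) +
      - ((p * c n ^+ 2 * z ^+ 2 + p * c n * u * z *+ 2) / 2)); last by ring.
    rewrite expRD EFinM; over.
  rewrite ge0_integralZl//=; last first.
  - apply/measurable_EFinP/measurableT_comp => //; apply: measurable_funN.
    apply: measurable_funM => //; apply: measurable_funD.
      by apply: measurable_funM => //; exact: measurable_funX.
    under eq_fun do rewrite -mulr_natr.
    by do 2![apply: measurable_funM => //].
  rewrite integral_normal_prob_expR_quad// -/q -!EFinM; congr EFin.
  rewrite mulrCA -expRD; congr (_ * expR _).
  by rewrite /q in q1 *; field.
rewrite ge0_integralZl//=; last first.
- apply/measurable_EFinP/measurableT_comp => //; apply: measurable_funN.
  apply: measurable_funM => //; apply: measurable_funM => //.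
  apply: measurable_funX; apply: measurable_funD => //.
  by apply: measurable_sum => j; apply: measurable_funM => //; case: HZ.
have pq0 : 0 <= p / q by rewrite divr_ge0// ltW.
rewrite (IH _ _ pq0) -EFinM mulrA -invfM -sqrtrM ?(ltW q0)//.
rewrite big_ord_recr /=; set C := \sum_(j < n) _.
have C0 : 0 <= C by apply: sumr_ge0 => j _; rewrite sqr_ge0.
have E1 : q * (1 + p / q * C) = 1 + p * (C + c n ^+ 2).
  by rewrite mulrDr mulr1 mulrA mulrCA divff// mulr1 /q; ring.
have E2 : p / q / (1 + p / q * C) = p / (1 + p * (C + c n ^+ 2)).
  by rewrite -E1 invfM mulrA.
by rewrite E1 E2.
Qed.

(** The offset [s] lets an induction drop the first coordinate. *)
Definition noise_from (s n : nat) (w : Omega) : 'cV[R]_n :=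
  \col_(j < n) Z (s + j) w.

(** Subtracting the identity compensates for the standard Gaussian density. Integrating out the
    first coordinate gives the inverse root of [a] and leaves the Schur complement, in step with
    [det_schur]. *)
Lemma integral_expR_quadratic (n s : nat) (B : 'M[R]_n) :
  B^T = B -> posdef_mx B ->
  (\int[P]_w (expR (- (((noise_from s n w)^T *m (B - 1%:M) *m
                        noise_from s n w) 0 0 / 2)))%:E =
   (Num.sqrt (\det B))^-1%:E)%E.
Proof.
elim: n s B => [|n IH] s B Bsym Bpos.
  under eq_integral do rewrite mxE big_ord0 mul0r oppr0 expR0.
  by rewrite integral_cst_probability det_mx00 sqrtr1 invr1.
have [a [b [B' BE]]] : exists (a : R) (b : 'rV[R]_n) (B' : 'M[R]_n),
    B = block_mx a%:M b b^T B' :> 'M[R]_(1 + n).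
  exists (B 0 0), (@ursubmx _ 1 n 1 n B), (@drsubmx _ 1 n 1 n B).
  rewrite -[LHS](@submxK _ 1 n 1 n B); congr block_mx.
    by apply/matrixP => i j; rewrite !ord1 !mxE mulr1n; congr (B _ _);
      apply/val_inj.
  by rewrite trmx_ursub Bsym.
subst B.
have a0 := posdef_pivot Bpos.
pose B2 := B' - a^-1 *: (b^T *m b).
have a1 : a != 0 by rewrite gt_eqF.
have B2sym : B2^T = B2.
  rewrite /B2 linearB /= linearZ /= trmx_mul trmxK; congr (_ - _).
  move: Bsym; rewrite (@tr_block_mx _ 1 n 1 n).
  by move=> /(@eq_block_mx _ 1 n 1 n)[].
pose T := g_sigma_algebraType (cylinders_off Z s).
pose N : T -> 'cV[R]_n := noise_from s.+1 n.
have mN : forall i j, measurable_fun setT (fun w : T => N w i j).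
  move=> i j; rewrite /N /noise_from; under eq_fun do rewrite mxE.
  by apply: measurable_off; rewrite addSn gtn_eqF// ltnS leq_addr.
have mN' : forall i j,
    measurable_fun setT (fun w : Omega => noise_from s.+1 n w i j).
  move=> i j; rewrite /noise_from; under eq_fun do rewrite mxE.
  by have [mZ _ _] := HZ; exact: mZ.
have noiseS w : noise_from s n.+1 w = col_mx (Z s w)%:M (noise_from s.+1 n w).
  apply/matrixP => i j; rewrite ord1 [LHS]mxE.
  case: (@split_ordP 1 n i) => l ->.
    by rewrite (@col_mxEu _ 1 n) ord1 mxE mulr1n /= addn0.
  by rewrite (@col_mxEd _ 1 n) mxE /= addnA addn1.
pose F (x : T * R) : \bar R := (expR (- (((a - 1) * x.2 ^+ 2 +
  (b *m N x.1) 0 0 * x.2 *+ 2 +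
  ((N x.1)^T *m (B' - 1%:M) *m N x.1) 0 0) / 2)))%:E.
have B1 : block_mx a%:M b b^T B' - 1%:M =
    block_mx (a - 1)%:M b b^T (B' - 1%:M) :> 'M[R]_(1 + n).
  rewrite (@scalar_mx_block _ 1 n) opp_block_mx add_block_mx !subr0.
  by rewrite -raddfB.
transitivity (\int[P]_w F (w, Z s w))%E.
  apply: eq_integral => w _; rewrite /F noiseS -block_quadratic.
  by rewrite B1.
rewrite (integral_off HZ); last 2 first.
- apply/measurable_EFinP/measurableT_comp => //; apply: measurable_funN.
  apply: measurable_funM => //; apply: measurable_funD.
    apply: measurable_funD.
      by apply: measurable_funM => //; apply: measurable_funX;
        exact: measurable_snd.
    under eq_fun do rewrite -mulr_natr.
    apply: measurable_funM => //; apply: measurable_funM; last first.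
      exact: measurable_snd.
    apply: (@measurableT_comp _ _ _ _ _ _ (fun w : T => (b *m N w) 0 0));
      last exact: measurable_fst.
    by apply: measurable_mulmx.
  apply: (@measurableT_comp _ _ _ _ _ _
    (fun w : T => ((N w)^T *m (B' - 1%:M) *m N w) 0 0));
      last exact: measurable_fst.
  apply: measurable_mulmx => //; apply: measurable_mulmx => // i j.
  by under eq_fun do rewrite mxE; exact: mN.
- by move=> x; rewrite lee_fin expR_ge0.
transitivity (\int[P]_w ((Num.sqrt a)^-1%:E *
    (expR (- (((noise_from s.+1 n w)^T *m (B2 - 1%:M) *m
                        noise_from s.+1 n w) 0 0 / 2)))%:E))%E.
  apply: eq_integral => w _; rewrite /F /= /N; set v := noise_from _ _ _.
  set Q := (_ *m _ *m v) 0 0; set u := (b *m v) 0 0.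
  under eq_integral => z _.
    rewrite (_ : - _ = - (Q / 2) +
      - (((a - 1) * z ^+ 2 + u * z *+ 2) / 2)); last by ring.
    rewrite expRD EFinM; over.
  have aE : 1 + (a - 1) = a by rewrite addrC subrK.
  rewrite ge0_integralZl//=; last first.
  - apply/measurable_EFinP/measurableT_comp => //; apply: measurable_funN.
    apply: measurable_funM => //; apply: measurable_funD.
      by apply: measurable_funM => //; exact: measurable_funX.
    under eq_fun do rewrite -mulr_natr.
    by do 2![apply: measurable_funM => //].
  rewrite integral_normal_prob_expR_quad aE// -!EFinM; congr EFin.
  rewrite mulrCA -expRD; congr (_ * expR _).
  (* Completing the square subtracts [u ^+ 2 / a], which is the rank-one correction in [B2]. *)
  suff -> : (v^T *m (B2 - 1%:M) *m v) 0 0 = Q - u ^+ 2 / a by field.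
  rewrite /B2 addrAC mulmxBr mulmxBl -scalemxAr -scalemxAl mulmxA -trmx_mul.
  have uu : ((b *m v)^T *m (b *m v)) 0 0 = u ^+ 2.
    by rewrite mxE big_ord1 [(b *m v)^T _ _]mxE expr2.
  have subZE (A1 A2 : 'M[R]_1) : (A1 - a^-1 *: A2) 0 0 = A1 0 0 - A2 0 0 / a.
    by rewrite !mxE mulrC.
  by rewrite -[_ *m b *m v]mulmxA subZE uu.
rewrite ge0_integralZl//=; last first.
- apply/measurable_EFinP/measurableT_comp => //; apply: measurable_funN.
  apply: measurable_funM => //.
  apply: measurable_mulmx => //; apply: measurable_mulmx => // i j.
  by under eq_fun do rewrite mxE; exact: mN'.
rewrite IH//; last exact: posdef_schur.
by rewrite -EFinM -invfM -sqrtrM ?(ltW a0)// (@det_schur _ n).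
Qed.

End GaussianIntegrals.

(** * Anti-concentration and tail bounds by Markov's inequality *)

Section ProbabilityBounds.
Context (R : realType) (d : measure_display) (Omega : measurableType d).
Variables (P : probability Omega R) (Z : nat -> Omega -> R).

Lemma probability_le_integral (A : set Omega) (f : Omega -> R) :
  measurable A -> measurable_fun setT f -> (forall w, 0 <= f w) ->
  (forall w, A w -> 1 <= f w) -> (P A <= \int[P]_w (f w)%:E)%E.
Proof.
move=> mA mf f0 f1; rewrite -(setIT A) -integral_indic//.
apply: ge0_le_integral => //.
- by apply/measurable_EFinP; exact: measurable_indic.
- exact/measurable_EFinP.
- move=> w _; rewrite lee_fin indicE.
  by have [/set_mem wA|_] := boolP (w \in A); [exact: f1|exact: f0].
Qed.

Hypothesis HZ : iid_std_normal P Z.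

(** The factor [expR 2^-1] makes a Gaussian bump at least 1 on its interval. The two summands serve
    large and small variance; neither weights nor centre occur. *)
Definition near_bound (e : R) := expR 2^-1 * (Num.sqrt e + 4 * e).

(* The indicator of [|V - x| <= e |x|] is dominated by a Gaussian bump of width
   [e |x|], whose expectation is explicit.  It is small either because the bump
   is much narrower than the spread of V, or because V is concentrated near 0
   compared with |x|. *)
Lemma probability_linear_near (n : nat) (c : nat -> R) (e x : R) :
  0 < e -> e <= 1 -> x != 0 ->
  (P [set w | (`|\sum_(j < n) c j * Z j w - x| <= e * `|x|)%R] <=
   (near_bound e)%:E)%E.
Proof.
move=> e0 e1 x0; pose V w := \sum_(j < n) c j * Z j w.
have mV : measurable_fun setT V.
  by apply: measurable_sum => j; apply: measurable_funM => //; case: HZ.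
have ex0 : 0 < e * `|x| by rewrite mulr_gt0// normr_gt0.
pose p := (e * `|x|) ^- 2.
have p0 : 0 < p by rewrite invr_gt0 exprn_gt0.
pose f w := expR 2^-1 * expR (- (p * (- x + V w) ^+ 2 / 2)).
have mf0 : measurable_fun setT (fun w => expR (- (p * (- x + V w) ^+ 2 / 2))).
  apply/measurableT_comp => //; apply: measurable_funN.
  apply: measurable_funM => //; apply: measurable_funM => //.
  by apply: measurable_funX; apply: measurable_funD.
have mA : measurable [set w | `|V w - x| <= e * `|x|].
  apply: measurable_set_le => //.
  by apply: measurableT_comp => //; exact: measurable_funB.
apply: le_trans (probability_le_integral (f := f) mA _ _ _) _.
- exact: measurable_funM.
- by move=> w; rewrite mulr_ge0 ?expR_ge0.
- move=> w /= Vx; rewrite /f -expRD -[leLHS]expR0 ler_expR.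
  suff : p * (- x + V w) ^+ 2 <= 1 by lra.
  rewrite /p mulrC ler_pdivrMr ?exprn_gt0// mul1r addrC.
  rewrite -[(V w - x) ^+ 2]real_normK ?num_real//.
  by rewrite ler_pXn2r// nnegrE// ltW.
rewrite /f; under eq_integral do rewrite EFinM.
rewrite ge0_integralZl//=; last exact/measurable_EFinP.
rewrite (integral_expR_linear HZ n c (- x) (ltW p0)) /= -EFinM lee_fin.
rewrite ler_pM2l ?expR_gt0//.
set C := \sum_(j < n) _.
have C0 : 0 <= C by apply: sumr_ge0 => j _; exact: sqr_ge0.
have pC0 : 0 <= p * C by rewrite mulr_ge0// ltW.
have q0 : 0 < 1 + p * C by rewrite ltr_pwDl.
have px2 : p * x ^+ 2 = e ^- 2.
  rewrite /p exprMn real_normK ?num_real// invfM -mulrA mulVf ?mulr1//.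
  by rewrite expf_neq0.
have := expR_ge0 (- (p / (1 + p * C) * (- x) ^+ 2 / 2)).
set E := expR _ => E0.
(* With [C] the variance of the sum, a large [p * C] makes the prefactor small, a small one the
   exponential. *)
have [pCe|pCe] := leP e^-1 (p * C).
  apply: (@le_trans _ _ (Num.sqrt e)); last by rewrite lerDl; lra.
  have se : (Num.sqrt (1 + p * C))^-1 <= Num.sqrt e.
    rewrite -[leRHS]invrK lef_pV2 ?posrE ?invr_gt0 ?sqrtr_gt0//.
    rewrite -(sqrtrV (ltW e0)); apply: ler_wsqrtr.
    by apply: le_trans pCe _; rewrite lerDr.
  have E1 : E <= 1.
    rewrite /E -[leRHS]expR0 ler_expR oppr_le0 mulr_ge0// mulr_ge0 ?sqr_ge0//.
    by rewrite divr_ge0// ltW.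
  by rewrite -[leRHS]mulr1; apply: ler_pM => //; rewrite invr_ge0 sqrtr_ge0.
apply: (@le_trans _ _ (4 * e)); last by rewrite lerDr sqrtr_ge0.
have s1 : (Num.sqrt (1 + p * C))^-1 <= 1.
  rewrite invf_le1 ?sqrtr_gt0// -[leLHS]sqrtr1.
  by apply: ler_wsqrtr; rewrite lerDl.
(* By [y <= expR y]: the exponent is at least [(4 * e)^-1] in absolute value because [e <= 1] and
   [e * (p * C) <= 1]. *)
have E4 : E <= 4 * e.
  rewrite /E expRN -[leRHS]invrK lef_pV2 ?posrE ?expR_gt0 ?invr_gt0 ?mulr_gt0//.
  apply: le_trans (expR_ge1Dx _).
  apply: (@le_trans _ _ (p / (1 + p * C) * (- x) ^+ 2 / 2));
    last by rewrite lerDr.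
  rewrite sqrrN (mulrAC p) px2 -mulrA -invfM -invfM.
  rewrite lef_pV2 ?posrE ?mulr_gt0 ?exprn_gt0//.
  have : e * (p * C) <= 1 by rewrite mulrC -ler_pdivlMr// mul1r ltW.
  by move=> H; nra.
by rewrite -[leRHS]mul1r; apply: ler_pM => //; rewrite invr_ge0 sqrtr_ge0.
Qed.

(** The optimised Chernoff factor per degree of freedom for a chi-square variable to pass [1 + h]
    times its mean. *)
Definition chernoff_base (h : R) := Num.sqrt ((1 + h) * expR (- h)).

(** The sign of [h] selects the tail, upper if positive and lower if negative, so one exponential
    bound serves both. *)
Lemma probability_residual_quad (n k : nat) (X : 'M[R]_(n, k)) (h : R) :
  \rank X = k -> -1 < h ->
  (P [set w | (0 <= h * (((noise_from Z 0 n w)^T *m residual_mx X *m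
                  noise_from Z 0 n w) 0 0 - (1 + h) * (n - k)%:R))%R] <=
   (chernoff_base h ^+ (n - k))%:E)%E.
Proof.
move=> rX h1; have uX := gram_unitmx rX.
have kn : (k <= n)%N by rewrite -rX rank_leq_row.
pose Q w := ((noise_from Z 0 n w)^T *m residual_mx X *m noise_from Z 0 n w) 0 0.
have mN i j : measurable_fun setT (fun w => noise_from Z 0 n w i j).
  have [mZ _ _] := HZ.
  by rewrite /noise_from; under eq_fun do rewrite mxE; exact: mZ.
have mQ : measurable_fun setT Q.
  apply: measurable_mulmx => //; apply: measurable_mulmx => // i j.
  by under eq_fun do rewrite mxE; exact: mN.
have h0 : 0 < 1 + h by lra.
have hn0 : 1 + h != 0 by rewrite gt_eqF.
(* The minimiser of the exponential bound. *)
pose t := - h / (1 + h).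
have tE : 1 + t = (1 + h)^-1 by rewrite /t; field.
have t0 : 0 < 1 + t by rewrite tE invr_gt0.
set m := (n - k)%N.
pose f w := expR (- h * m%:R / 2) * expR (- (t * Q w / 2)).
have mf0 : measurable_fun setT (fun w => expR (- (t * Q w / 2))).
  apply/measurableT_comp => //; apply: measurable_funN.
  by apply: measurable_funM => //; apply: measurable_funM.
have mA : measurable [set w | 0 <= h * (Q w - (1 + h) * m%:R)].
  apply: measurable_set_le => //.
  by apply: measurable_funM => //; exact: measurable_funB.
apply: le_trans (probability_le_integral (f := f) mA _ _ _) _.
- exact: measurable_funM.
- by move=> w; rewrite mulr_ge0 ?expR_ge0.
- move=> w /= Vx; rewrite /f -expRD -[leLHS]expR0 ler_expR.
  have -> : - h * m%:R / 2 + - (t * Q w / 2) =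
      h * (Q w - (1 + h) * m%:R) / (1 + h) / 2 by rewrite /t; field.
  by rewrite !divr_ge0// ltW.
have quadE w : ((noise_from Z 0 n w)^T *m (1%:M + t *: residual_mx X - 1%:M) *m
    noise_from Z 0 n w) 0 0 = t * Q w.
  by rewrite addrAC subrr add0r -scalemxAr -scalemxAl mxE.
rewrite /f; under eq_integral do rewrite EFinM.
rewrite ge0_integralZl//=; last exact/measurable_EFinP.
rewrite (_ : \int[P]_w _ = (Num.sqrt ((1 + h)^-1 ^+ m))^-1%:E)%E; last first.
  rewrite -tE -(det_add1_residual uX kn t0) -(integral_expR_quadratic HZ 0).
  - by apply: eq_integral => w _; rewrite quadE.
  - by rewrite linearD linearZ /= trmx1 residual_mx_tr.
  - exact: posdef_add1_residual.
rewrite -EFinM lee_fin le_eqVlt; apply/orP; left; apply/eqP.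
rewrite /chernoff_base.
rewrite -sqrtrV ?exprn_ge0 ?invr_ge0 ?(ltW h0)// -exprVn invrK.
have sqrtX (y : R) j : 0 <= y -> Num.sqrt (y ^+ j) = Num.sqrt y ^+ j.
  by move=> y0; elim: j => [|j IH]; rewrite ?expr0 ?sqrtr1// !exprS sqrtrM// IH.
rewrite sqrtX ?(ltW h0)// sqrtrM ?(ltW h0)// exprMn mulrC; congr (_ * _).
have -> : expR (- h) = expR (- h / 2) ^+ 2.
  by rewrite -expRM_natl; congr expR; field.
by rewrite sqrtr_sqr gtr0_norm ?expR_gt0// -expRM_natl; congr expR; ring.
Qed.

End ProbabilityBounds.

(** * Coverage by intervals around the soft-thresholding estimator *)

Section SoftThreshold.
Context (R : realType).
Implicit Types b t v A : R.

(** A form without sign or absolute value, suited to linear case analysis and to measurability. *)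
Lemma softE b t : 0 <= t ->
  soft b t = Num.max (b - t) 0 + Num.min (b + t) 0.
Proof.
move=> t0; rewrite /soft; have [b0|b0|->] := ltgtP b 0.
- rewrite ltr0_sg// ltr0_norm// /Num.max /Num.min.
  by case: ltP => ?; case: ltP => ?; case: ltP => ?; lra.
- rewrite gtr0_sg// gtr0_norm// /Num.max /Num.min.
  by case: ltP => ?; case: ltP => ?; lra.
- by rewrite sgr0 mul0r /Num.max /Num.min; case: ltP => ?; case: ltP => ?; lra.
Qed.

(** Either [soft b t] equals [b - t], or it lies between [b - t] and [0 <= th], and so is no farther
    from [th]. *)
Lemma soft_cover_pos b t th A : 0 <= t -> 0 <= th -> `|b - th - t| <= A ->
  soft b t - A <= th <= soft b t + A.
Proof.
move=> t0 th0; rewrite ler_norml softE// /Num.max /Num.min => /andP[? ?].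
by apply/andP; split; case: ltP => ?; case: ltP => ?; lra.
Qed.

Lemma soft_cover_neg b t th A : 0 <= t -> th <= 0 -> `|b - th + t| <= A ->
  soft b t - A <= th <= soft b t + A.
Proof.
move=> t0 th0; rewrite ler_norml softE// /Num.max /Num.min => /andP[? ?].
by apply/andP; split; case: ltP => ?; case: ltP => ?; lra.
Qed.

(** Coverage with [A < th] forces [soft b t] to be positive, and then it equals [b - t]. *)
Lemma soft_cover_pos_inv b t th A : 0 <= t -> A < th ->
  soft b t - A <= th <= soft b t + A -> `|b - th - t| <= A.
Proof.
move=> t0 th0; rewrite ler_norml softE// /Num.max /Num.min.
by case: ltP => ?; case: ltP => ? /andP[? ?]; apply/andP; split; lra.
Qed.

Lemma soft_cover_neg_inv b t th A : 0 <= t -> th < - A ->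
  soft b t - A <= th <= soft b t + A -> `|b - th + t| <= A.
Proof.
move=> t0 th0; rewrite ler_norml softE// /Num.max /Num.min.
by case: ltP => ?; case: ltP => ? /andP[? ?]; apply/andP; split; lra.
Qed.

Lemma measurable_soft_cover (d : measure_display) (T : measurableType d)
    (b t A : T -> R) (th : R) :
  measurable_fun setT b -> measurable_fun setT t -> measurable_fun setT A ->
  (forall w, 0 <= t w) ->
  measurable [set w | soft (b w) (t w) - A w <= th <= soft (b w) (t w) + A w].
Proof.
move=> mb mt mA t0.
have ms : measurable_fun setT (fun w => soft (b w) (t w)).
  under eq_fun do rewrite softE//.
  apply: measurable_funD.
    by apply: measurable_maxr => //; exact: measurable_funB.
  by apply: measurable_minr => //; exact: measurable_funD.
rewrite (_ : [set w | _] = [set w | soft (b w) (t w) - A w <= th] `&`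
    [set w | th <= soft (b w) (t w) + A w]); last first.
  by apply/seteqP; split => w /= => [/andP[]|[? ?]]//; apply/andP.
by apply: measurableI; apply: measurable_set_le => //;
  [exact: measurable_funB|exact: measurable_funD].
Qed.

End SoftThreshold.

(** * Equivariance of the least squares and scale estimators *)

Section Regression.
Context (R : realType) (n k : nat) (X : 'M[R]_(n, k)).
Hypothesis uX : X^T *m X \in unitmx.

Lemma theta_LS_linear (theta : 'cV[R]_k) (s : R) (z : 'cV[R]_n) :
  theta_LS X (X *m theta + s *: z) = theta + s *: theta_LS X z.
Proof.
rewrite /theta_LS !mulmxDr [X^T *m (X *m _)]mulmxA mulmxA mulVmx// mul1mx.
by rewrite -!scalemxAr.
Qed.

Lemma sigma_hatE (z : 'cV[R]_n) :
  sigma_hat X z = Num.sqrt ((z^T *m residual_mx X *m z) 0 0 / (n - k)%:R).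
Proof.
rewrite /sigma_hat residual_quad//; congr (Num.sqrt (_ / _)).
suff -> : z - X *m theta_LS X z = residual_mx X *m z by [].
by rewrite /residual_mx mulmxBl mul1mx /theta_LS !mulmxA.
Qed.

Lemma sigma_hat_linear (theta : 'cV[R]_k) (s : R) (z : 'cV[R]_n) : 0 < s ->
  sigma_hat X (X *m theta + s *: z) = s * sigma_hat X z.
Proof.
move=> s0; rewrite /sigma_hat theta_LS_linear.
have -> : X *m theta + s *: z - X *m (theta + s *: theta_LS X z) =
    s *: (z - X *m theta_LS X z).
  by rewrite mulmxDr -scalemxAr scalerBr opprD addrACA subrr add0r.
set r := z - _; have -> : (s *: r)^T = s *: r^T by rewrite linearZ.
rewrite -scalemxAl -scalemxAr scalerA -expr2.
by rewrite mxE -mulrA sqrtrM ?sqr_ge0// sqrtr_sqr gtr0_norm.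
Qed.

Lemma vcoordD (u v : 'cV[R]_k) (s : R) (i : nat) :
  vcoord (u + s *: v) i = vcoord u i + s * vcoord v i.
Proof.
by rewrite /vcoord; case: insubP => [j _ _|_]; rewrite ?mxE ?mulr0 ?addr0.
Qed.

Lemma vcoord_const (i : nat) (x : R) : (i < k)%N ->
  vcoord (const_mx x : 'cV[R]_k) i = x.
Proof. by move=> ik; rewrite /vcoord insubT mxE. Qed.

(** The weights are a row of the least squares matrix, extended by 0 to all naturals to fit
    [integral_expR_linear]. *)
Lemma vcoord_theta_LS_sum (i : nat) : exists c : nat -> R,
  forall z : nat -> R, vcoord (theta_LS X (\col_(j < n) z j)) i =
    \sum_(j < n) c j * z j.
Proof.
rewrite /vcoord; case: insubP => [l _ _|_]; last first.
  by exists (fun=> 0) => z'; rewrite big1// => j _; rewrite mul0r.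
exists (fun j => if insub j is Some j' then
  (invmx (X^T *m X) *m X^T) l j' else 0) => z'.
rewrite /theta_LS mulmxA mxE; apply: eq_bigr => j _.
by rewrite /= valK [X in _ * X]mxE.
Qed.

End Regression.

(** * Replacing a random scale by 1 in interval probabilities *)

Section Comparison.
Context (R : realType) (d : measure_display) (Omega : measurableType d).
Variables (P : probability Omega R) (V S : Omega -> R) (e nb cb : R).
Hypotheses (mV : measurable_fun setT V) (mS : measurable_fun setT S).
Hypothesis V_near : forall x, x != 0 ->
  (P [set w | (`|V w - x| <= e * `|x|)%R] <= nb%:E)%E.
Hypothesis S_near1 : (P [set w | (e < `|S w - 1|)%R] <= cb%:E)%E.
Hypothesis nb0 : 0 <= nb.

Lemma measurable_scale_far : measurable [set w | e < `|S w - 1|].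
Proof.
rewrite -[X in measurable X]setTI.
apply: (measurable_fun_ltr (f := cst e) (g := fun w => `|S w - 1|) _ _
  measurableT (Y := [set true])) => //.
by apply: measurableT_comp => //; exact: measurable_funB.
Qed.

(** The point 0 is left out since rescaling does not move an end point at 0. *)
Definition near_set (x : R) : set Omega :=
  [set w | x != 0 /\ `|V w - x| <= e * `|x|].

Lemma measurable_near_set x : measurable (near_set x).
Proof.
rewrite /near_set; have [->|x0] := eqVneq x 0.
  by rewrite (_ : [set w | _] = set0)//; apply/seteqP; split => w // [].
rewrite (_ : [set w | _] = [set w | `|V w - x| <= e * `|x|]); last first.
  by apply/seteqP; split => w // [].
apply: measurable_set_le => //.
by apply: measurableT_comp => //; exact: measurable_funB.
Qed.

Lemma probability_near_set x : (P (near_set x) <= nb%:E)%E.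
Proof.
rewrite /near_set; have [->|x0] := eqVneq x 0.
  rewrite (_ : [set w | _] = set0) ?measure0//.
  by apply/seteqP; split => w // [].
rewrite (_ : [set w | _] = [set w | `|V w - x| <= e * `|x|]); last first.
  by apply/seteqP; split => w // [].
exact: V_near.
Qed.

(** Outside this set [scaled_side] applies at both end points, so rescaling does not change whether
    the interval contains [V w]. *)
Definition bad_set (t a : R) : set Omega :=
  [set w | e < `|S w - 1|] `|` (near_set (t - a) `|` near_set (t + a)).

Lemma measurable_bad_set t a : measurable (bad_set t a).
Proof.
apply: measurableU; first exact: measurable_scale_far.
by apply: measurableU; exact: measurable_near_set.
Qed.

Lemma probability_bad_set t a : (P (bad_set t a) <= (cb + 2 * nb)%:E)%E.
Proof.
have mn := measurable_near_set.
apply: le_trans (measureU2 _ _ _) _ => //.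
- exact: measurable_scale_far.
- exact: measurableU.
rewrite mulr_natl mulr2n !EFinD; apply: leeD => //.
apply: le_trans (measureU2 _ _ _) _ => //.
by apply: leeD; exact: probability_near_set.
Qed.

(* Off the bad set, S x lies on the same side of V as x. *)
Lemma scaled_side x v s : `|s - 1| <= e -> ~ (x != 0 /\ `|v - x| <= e * `|x|) ->
  ((s * x <= v) = (x <= v)) * ((v <= s * x) = (v <= x)).
Proof.
move=> se far; have [->|x0] := eqVneq x 0; first by rewrite mulr0.
have {far} : e * `|x| < `|v - x| by rewrite ltNge; apply/negP => H; exact: far.
have : `|s * x - x| <= e * `|x|.
  by rewrite -[X in _ - X]mul1r -mulrBl normrM ler_wpM2r.
rewrite ler_norml => /andP[? ?]; rewrite ltr_normr => H.
by split; apply/idP/idP => ?; case/orP: H => ?; lra.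
Qed.

Lemma scaled_interval t a w : ~ bad_set t a w ->
  (`|V w - S w * t| <= S w * a) = (`|V w - t| <= a).
Proof.
move=> nbad; have se : `|S w - 1| <= e.
  by rewrite leNgt; apply/negP => H; apply: nbad; left.
have [|l1 _] := @scaled_side (t - a) (V w) _ se.
  by move=> H; apply: nbad; right; left.
have [|_ l2] := @scaled_side (t + a) (V w) _ se.
  by move=> H; apply: nbad; right; right.
by rewrite !ler_distl -mulrBr -mulrDr l1 l2.
Qed.

Lemma measurable_scaled t a : measurable [set w | `|V w - S w * t| <= S w * a].
Proof.
apply: measurable_set_le; last exact: measurable_funM.
apply: measurableT_comp => //; apply: measurable_funB => //.
exact: measurable_funM.
Qed.

Lemma measurable_unscaled t a : measurable [set w | `|V w - t| <= a].
Proof.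
apply: measurable_set_le => //.
by apply: measurableT_comp => //; exact: measurable_funB.
Qed.

Let le_up_to_bad t a (A B : set Omega) : measurable A -> measurable B ->
  A `<=` B `|` bad_set t a -> (P A <= P B + (cb + 2 * nb)%:E)%E.
Proof.
move=> mA mB AB; apply: (@le_trans _ _ (P (B `|` bad_set t a))).
  by apply: le_measure; rewrite ?inE//; apply: measurableU => //;
    exact: measurable_bad_set.
apply: le_trans (measureU2 _ _ _) _ => //; first exact: measurable_bad_set.
by apply: leeD => //; exact: probability_bad_set.
Qed.

Lemma probability_scaled_le t a :
  (P [set w | (`|V w - S w * t| <= S w * a)%R] <=
   P [set w | (`|V w - t| <= a)%R] + (cb + 2 * nb)%:E)%E.
Proof.
apply: (@le_up_to_bad t a).
- exact: measurable_scaled.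
- exact: measurable_unscaled.
- move=> w /= H; have [|nbad] := pselect (bad_set t a w); first by right.
  by left; rewrite -scaled_interval.
Qed.

Lemma probability_unscaled_le t a :
  (P [set w | (`|V w - t| <= a)%R] <=
   P [set w | (`|V w - S w * t| <= S w * a)%R] + (cb + 2 * nb)%:E)%E.
Proof.
apply: (@le_up_to_bad t a).
- exact: measurable_unscaled.
- exact: measurable_scaled.
- move=> w /= H; have [|nbad] := pselect (bad_set t a w); first by right.
  by left; rewrite scaled_interval.
Qed.

End Comparison.

(** * Bounds on the infimal coverage probabilities *)

Section CoverageComparison.
Context (R : realType) (d : measure_display) (Omega : measurableType d).
Variables (P : probability Omega R) (Z : nat -> Omega -> R).
Hypothesis HZ : iid_std_normal P Z.

Variables (n k : nat) (X : 'M[R]_(n, k)) (i : nat).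
Hypotheses (rX : \rank X = k) (ik : (i < k)%N) (kn : (0 < n - k)%N).

Let uX : X^T *m X \in unitmx := gram_unitmx rX.
Let z w : 'cV[R]_n := \col_(j < n) Z j w.
Let V w := vcoord (theta_LS X (z w)) i.
Let S w := sigma_hat X (z w).
Let Q w := ((z w)^T *m residual_mx X *m z w) 0 0.

Let mZ j : measurable_fun setT (Z j). Proof. by case: HZ. Qed.

Let mQ : measurable_fun setT Q.
Proof.
have mz i' j : measurable_fun setT (fun w => z w i' j).
  by rewrite /z; under eq_fun do rewrite mxE; exact: mZ.
apply: measurable_mulmx => //; apply: measurable_mulmx => // i' j.
by under eq_fun do rewrite mxE; exact: mz.
Qed.

Let SE w : S w = Num.sqrt (Q w / (n - k)%:R).
Proof. exact: sigma_hatE. Qed.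

Let Q0 w : 0 <= Q w.
Proof. by rewrite /Q residual_quad// gram_ge0. Qed.

Let S0 w : 0 <= S w.
Proof. by rewrite SE sqrtr_ge0. Qed.

Let mS : measurable_fun setT S.
Proof.
apply: (eq_measurable_fun (fun w => Num.sqrt (Q w / (n - k)%:R))).
  by move=> w _; rewrite SE.
have msqrt : measurable_fun [set: R] (@Num.sqrt R).
  by apply: continuous_measurable_fun; exact: sqrt_continuous.
by apply: (measurableT_comp msqrt); exact: measurable_funM.
Qed.

Let V_sum : exists c : nat -> R, forall w, V w = \sum_(j < n) c j * Z j w.
Proof.
by have [c cE] := vcoord_theta_LS_sum X i; exists c => w; exact: (cE (Z ^~ w)).
Qed.

Let mV : measurable_fun setT V.
Proof.
have [c cE] := V_sum; rewrite (funext cE).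
by apply: measurable_sum => j; exact: measurable_funM.
Qed.

(** Since [(1 + e) ^+ 2 >= 1 + e] and [(1 - e) ^+ 2 <= 1 - e], a deviation of [S w] from 1 by more
    than [e] puts [S w ^+ 2] in a chi-square tail at level [e] or [- e]. *)
Lemma probability_sigma_hat_far (e : R) : 0 < e -> e < 1 ->
  (P [set w | (e < `|S w - 1|)%R] <=
   (chernoff_base e ^+ (n - k) + chernoff_base (- e) ^+ (n - k))%:E)%E.
Proof.
move=> e0 e1; set m := (n - k)%N.
have m0 : 0 < m%:R :> R by rewrite ltr0n.
pose B h := [set w | 0 <= h * (Q w - (1 + h) * m%:R)].
have mB h : measurable (B h).
  apply: measurable_set_le => //.
  by apply: measurable_funM => //; exact: measurable_funB.
have PB h : -1 < h -> (P (B h) <= (chernoff_base h ^+ m)%:E)%E.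
  by move=> h1; exact: (probability_residual_quad HZ rX h1).
apply: (@le_trans _ _ (P (B e `|` B (- e)))).
  apply: le_measure; rewrite ?inE.
  - exact: measurable_scale_far.
  - exact: measurableU.
  - move=> w /=.
    have S2 : S w ^+ 2 = Q w / m%:R by rewrite SE sqr_sqrtr// divr_ge0// ltW.
    have QE : Q w = S w ^+ 2 * m%:R by rewrite S2 divfK// gt_eqF.
    have Sw := S0 w; rewrite ltr_normr => /orP[H|H]; [left|right];
      rewrite /B /= QE -mulrBl mulrA.
      apply: mulr_ge0; last exact: ltW.
      by apply: mulr_ge0; [exact: ltW|nra].
    apply: mulr_ge0; last exact: ltW.
    rewrite mulNr -mulrN; apply: mulr_ge0; [exact: ltW|nra].
apply: le_trans (measureU2 _ _ _) _ => //.
by rewrite EFinD; apply: leeD; apply: PB; lra.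
Qed.

Variables (eta a : R).
Hypotheses (eta0 : 0 < eta) (a0 : 0 <= a).
Let tau := xi X i * eta.

Let tau0 : 0 <= tau.
Proof. by rewrite mulr_ge0 ?sqrtr_ge0// ltW. Qed.

Let VobsE theta s w :
  vcoord (theta_LS X (obs Z X theta s w)) i = vcoord theta i + s * V w.
Proof. by rewrite /obs /noise theta_LS_linear// vcoordD. Qed.

Lemma covEE (theta : 'cV[R]_k) (s : R) : 0 < s ->
  let b w := vcoord theta i + s * V w in
  covE P Z X eta a i theta s =
  P [set w | (soft (b w) (s * S w * tau) - s * S w * a <= vcoord theta i
              <= soft (b w) (s * S w * tau) + s * S w * a)%R].
Proof.
move=> s0 b; rewrite /covE; congr (P _); apply/funext => w /=.
rewrite /theta_S_feas VobsE /obs /noise sigma_hat_linear//.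
by rewrite -mulrA.
Qed.

Lemma covCE (theta : 'cV[R]_k) (s : R) :
  let b w := vcoord theta i + s * V w in
  covC P Z X eta a i theta s =
  P [set w | (soft (b w) (s * tau) - s * a <= vcoord theta i
              <= soft (b w) (s * tau) + s * a)%R].
Proof.
move=> b; rewrite /covC; congr (P _); apply/funext => w /=.
by rewrite /theta_S VobsE -mulrA.
Qed.

Let scale_norm (s v t A : R) : 0 < s ->
  (`|s * v - s * t| <= s * A) = (`|v - t| <= A).
Proof. by move=> s0; rewrite -mulrBr normrM gtr0_norm// ler_pM2l. Qed.

Let addBK (x y : R) : x + y - x = y.
Proof. by rewrite addrAC subrr add0r. Qed.

Let mb (theta : 'cV[R]_k) (s : R) :
  measurable_fun setT (fun w => vcoord theta i + s * V w : R).
Proof. by apply: measurable_funD => //; exact: measurable_funM. Qed.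

Let mcovE (theta : 'cV[R]_k) (s : R) : 0 < s -> measurable [set w |
  soft (vcoord theta i + s * V w) (s * S w * tau) - s * S w * a
    <= vcoord theta i
    <= soft (vcoord theta i + s * V w) (s * S w * tau) + s * S w * a].
Proof.
move=> s0; have msS : measurable_fun setT (fun w => s * S w).
  exact: measurable_funM.
apply: measurable_soft_cover => //; try exact: measurable_funM.
by move=> w; rewrite mulr_ge0// mulr_ge0// ltW.
Qed.

Let mcovC (theta : 'cV[R]_k) (s : R) : 0 < s -> measurable [set w |
  soft (vcoord theta i + s * V w) (s * tau) - s * a
    <= vcoord theta i
    <= soft (vcoord theta i + s * V w) (s * tau) + s * a].
Proof.
move=> s0; apply: measurable_soft_cover => // w.
by rewrite mulr_ge0// ltW.
Qed.

(** The sign of the covered coordinate selects [t], and [s] cancels, so the lower bound takes only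
    two values over all parameters. *)
Let coverE_lb (theta : 'cV[R]_k) s : 0 < s -> exists2 t, t = tau \/ t = - tau &
  (P [set w | (`|V w - S w * t| <= S w * a)%R] <= covE P Z X eta a i theta s)%E.
Proof.
move=> s0.
have stau w : 0 <= s * S w * tau by rewrite mulr_ge0// mulr_ge0// ltW.
have [th0|th0] := leP 0 (vcoord theta i); [exists tau|exists (- tau)];
  [by left| |by right|]; rewrite covEE//.
all: apply: le_measure; rewrite ?inE; [exact: measurable_scaled|exact: mcovE|].
all: move=> w /=; rewrite -(scale_norm _ _ _ s0) => H.
- apply: soft_cover_pos => //.
  by rewrite addBK -!mulrA.
- apply: soft_cover_neg => //; first exact: ltW.
  by rewrite addBK -!mulrA; rewrite 2!mulrN opprK in H.
Qed.

Let coverC_lb (theta : 'cV[R]_k) s : 0 < s -> exists2 t, t = tau \/ t = - tau &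
  (P [set w | (`|V w - t| <= a)%R] <= covC P Z X eta a i theta s)%E.
Proof.
move=> s0; have stau : 0 <= s * tau by rewrite mulr_ge0// ltW.
have [th0|th0] := leP 0 (vcoord theta i); [exists tau|exists (- tau)];
  [by left| |by right|]; rewrite covCE.
all: apply: le_measure; rewrite ?inE; [exact: measurable_unscaled|exact: mcovC|].
all: move=> w /=; rewrite -(scale_norm _ _ _ s0) => H.
- apply: soft_cover_pos => //.
  by rewrite addBK.
- apply: soft_cover_neg => //; first exact: ltW.
  by rewrite addBK; rewrite mulrN opprK in H.
Qed.

Let infC_ub (sigma t : R) : 0 < sigma -> t = tau \/ t = - tau ->
  (infC P Z X eta a i sigma <= P [set w | (`|V w - t| <= a)%R])%E.
Proof.
move=> s0 tE; have stau : 0 <= sigma * tau by rewrite mulr_ge0// ltW.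
have as0 : 0 <= sigma * a by rewrite mulr_ge0// ltW.
(* The added 1 puts the coordinate strictly beyond the half-width. If [tau = 0], both values of [t]
   coincide and the positive choice serves. *)
pose th : R := if t == tau then sigma * a + 1 else - (sigma * a + 1).
apply: (@le_trans _ _ (covC P Z X eta a i (const_mx th) sigma)).
  by apply: ereal_inf_lbound; exists (const_mx th).
rewrite covCE vcoord_const//; apply: le_measure; rewrite ?inE.
- by have := mcovC (const_mx th) s0; rewrite vcoord_const.
- exact: measurable_unscaled.
- move=> w /=; rewrite -(scale_norm _ _ _ s0) /th.
  have [->|tn] := eqVneq t tau => H.
    have := soft_cover_pos_inv stau _ H; rewrite addBK; apply.
    by rewrite ltrDl.
  have {tn tE} -> : t = - tau by case: tE tn => // ->; rewrite eqxx.
  have := soft_cover_neg_inv stau _ H.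
  by rewrite addBK mulrN opprK; apply; rewrite ltrN2 ltrDl.
Qed.

(** The half-width [S w * a] is random here: it stays below [M] while [S w] is within [e] of 1, and
    the exceptional event costs [cb]. *)
Let infE_ub (e cb t : R) : 0 < e -> t = tau \/ t = - tau ->
  (P [set w | (e < `|S w - 1|)%R] <= cb%:E)%E ->
  (infE P Z X eta a i <=
   P [set w | (`|V w - S w * t| <= S w * a)%R] + cb%:E)%E.
Proof.
move=> e0 tE Pfar; pose M := (1 + e) * a + 1.
pose th : R := if t == tau then M else - M.
apply: (@le_trans _ _ (covE P Z X eta a i (const_mx th) 1)).
  by apply: ereal_inf_lbound; exists (const_mx th), 1.
apply: (@le_trans _ _ (P ([set w | `|V w - S w * t| <= S w * a] `|`
    [set w | e < `|S w - 1|]))); last first.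
  apply: le_trans (measureU2 _ _ _) _ => //.
  - exact: measurable_scaled.
  - exact: measurable_scale_far.
  - exact: leeD.
rewrite covEE// vcoord_const//; apply: le_measure; rewrite ?inE.
- by have := mcovE (const_mx th) ltr01; rewrite vcoord_const.
- by apply: measurableU; [exact: measurable_scaled|exact: measurable_scale_far].
- move=> w /=; rewrite !mul1r /th => H.
  have [far|near] := ltP e `|S w - 1|; [by right|left].
  have SM : S w * a < M.
    rewrite /M ltr_pwDr// ler_wpM2r//.
    by move: near; rewrite ler_norml => /andP[? ?]; lra.
  have stau : 0 <= S w * tau by rewrite mulr_ge0.
  have [tt|tn] := eqVneq t tau.
    rewrite tt; move: H; rewrite tt eqxx => /(soft_cover_pos_inv stau SM).
    by rewrite addBK.
  have {}tE : t = - tau by case: tE tn => // ->; rewrite eqxx.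
  move: H; rewrite (negbTE tn) => /(soft_cover_neg_inv stau).
  by rewrite addBK tE mulrN opprK; apply; rewrite ltrN2.
Qed.

(** Scale deviations are paid for twice, in [infE_ub] and in the change of scale; [near_bound] once
    per end point. *)
Definition coverage_error (e : R) :=
  2 * (chernoff_base e ^+ (n - k) + chernoff_base (- e) ^+ (n - k)) +
  2 * near_bound e.

Lemma infC_le1 (sigma : R) : 0 < sigma -> (infC P Z X eta a i sigma <= 1)%E.
Proof.
move=> s0; apply: le_trans (infC_ub s0 (or_introl (erefl tau))) _.
by apply: probability_le1; exact: measurable_unscaled.
Qed.

(** Any parameter on one side selects a [t]; the upper bound on the other infimum holds for both
    values of [t], and the change of scale links the two interval probabilities. *)
Lemma infE_infC_close (sigma e : R) : 0 < sigma -> 0 < e -> e < 1 ->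
  (infE P Z X eta a i <= infC P Z X eta a i sigma + (coverage_error e)%:E)%E /\
  (infC P Z X eta a i sigma <= infE P Z X eta a i + (coverage_error e)%:E)%E.
Proof.
move=> s0 e0 e1.
pose cb := chernoff_base e ^+ (n - k) + chernoff_base (- e) ^+ (n - k).
pose nb := near_bound e.
have nb0 : 0 <= nb.
  rewrite /nb /near_bound mulr_ge0 ?expR_ge0// addr_ge0 ?sqrtr_ge0//.
  by rewrite mulr_ge0// ltW.
have cb0 : 0 <= cb by rewrite addr_ge0// exprn_ge0// sqrtr_ge0.
have Pfar := probability_sigma_hat_far e0 e1.
have Vnear x : x != 0 -> (P [set w | (`|V w - x| <= e * `|x|)%R] <= nb%:E)%E.
  move=> x0; have [c cE] := V_sum.
  rewrite (_ : [set w | _] =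
      [set w | `|\sum_(j < n) c j * Z j w - x| <= e * `|x|]); last first.
    by apply/funext => w /=; rewrite cE.
  by apply: probability_linear_near => //; exact: ltW.
have errE : coverage_error e = (cb + 2 * nb) + cb.
  by rewrite /coverage_error -/cb -/nb; ring.
split.
- rewrite -leeBlDr//; apply: le_ereal_inf_tmp => _ [theta ->].
  rewrite leeBlDr//.
  have [t tE Pt] := coverC_lb theta s0.
  apply: le_trans (infE_ub e0 tE Pfar) _.
  rewrite errE (EFinD (cb + 2 * nb)) addeA; apply: leeD => //.
  apply: le_trans (probability_scaled_le mV mS Vnear Pfar nb0 t a) _.
  exact: leeD.
- rewrite -leeBlDr//; apply: le_ereal_inf_tmp => _ [theta [s [sp ->]]].
  rewrite leeBlDr//.
  have [t tE Pt] := coverE_lb theta sp.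
  apply: le_trans (infC_ub s0 tE) _.
  apply: le_trans (probability_unscaled_le mV mS Vnear Pfar nb0 t a) _.
  by apply: leeD => //; rewrite lee_fin errE lerDl.
Qed.

End CoverageComparison.

(** * Vanishing of the error bounds *)

Section Limits.
Context (R : realType).

(** Amounts to the strict inequality [1 + h < expR h] for nonzero [h]. *)
Lemma chernoff_base_lt1 (h : R) : -1 < h -> h != 0 -> chernoff_base h < 1.
Proof.
move=> h1 h0; rewrite /chernoff_base -[ltRHS]sqrtr1.
rewrite ltr_sqrt// expRN ltr_pdivrMr ?expR_gt0// mul1r.
exact: expR_gt1Dx.
Qed.

Lemma chernoff_base_cvg (h : R) : -1 < h -> h != 0 ->
  chernoff_base h ^+ m @[m --> \oo] --> (0 : R).
Proof.
move=> h1 h0; apply: cvg_expr.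
by rewrite ger0_norm ?sqrtr_ge0//; exact: chernoff_base_lt1.
Qed.

Lemma near_bound_small (eps : R) : 0 < eps ->
  exists e : R, [/\ 0 < e, e < 1 & near_bound e < eps].
Proof.
move=> eps0; set K := expR (2^-1 : R); have K0 : 0 < K := expR_gt0 _.
(* With [e = u ^+ 2] the bound is [K * (u + 4 * u ^+ 2)], which is below [6 * K * u] as [u] is at
   most one half. *)
pose u := Num.min 2^-1 (eps / (6 * K)).
have u0 : 0 < u by rewrite lt_min invr_gt0 ltr0n divr_gt0// mulr_gt0.
have u12 : u <= 2^-1 by rewrite ge_min lexx.
have uK : u * (6 * K) <= eps.
  by rewrite -ler_pdivlMr ?mulr_gt0// ge_min lexx orbT.
exists (u ^+ 2); split; first exact: exprn_gt0.
  by rewrite expr2; nra.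
rewrite /near_bound -/K sqrtr_sqr gtr0_norm//.
apply: lt_le_trans uK; rewrite expr2 (_ : u * (6 * K) = K * (u * 6)); last ring.
by rewrite ltr_pM2l//; nra.
Qed.

End Limits.

(** * Convergence of the difference of infima as [n - k] tends to infinity *)

Theorem theorem17 (R : realType) (d : measure_display) (Omega : measurableType d)
  (P : probability Omega R) (Z : nat -> Omega -> R)
  (k : nat -> nat) (X : forall n : nat, 'M[R]_(n, k n))
  (eta : nat -> R) (a : nat -> R) (i : nat) :
  iid_std_normal P Z ->
  (forall n, (0 < n)%N -> (0 < k n)%N /\ \rank (X n) = k n) ->
  (forall n, 0 < eta n) ->
  (forall n, 0 <= a n) ->
  (exists M : R, forall n, xi (X n) i ^+ 2 / n%:R <= M) ->
  (exists N, forall n, (N <= n)%N -> (i < k n)%N) ->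
  (xi (X n) i * eta n : R) @[n --> \oo] --> 0 ->
  forall sigma : R, 0 < sigma ->
  forall phi : nat -> nat,
    (forall M : nat, \forall j \near \oo, (M <= phi j - k (phi j))%N) ->
    ((infE P Z (X (phi j)) (eta (phi j)) (a (phi j)) i
      - infC P Z (X (phi j)) (eta (phi j)) (a (phi j)) i sigma)%E : \bar R)
      @[j --> \oo] --> 0%E.
Proof.
move=> HZ rX eta0 a0 _ [N ik] _ sigma s0 phi phioo.
pose E j := infE P Z (X (phi j)) (eta (phi j)) (a (phi j)) i.
pose C j := infC P Z (X (phi j)) (eta (phi j)) (a (phi j)) i sigma.
have E0 j : (0 <= E j)%E.
  by apply: le_ereal_inf_tmp => _ [theta [s [_ ->]]].
have C0 j : (0 <= C j)%E by apply: le_ereal_inf_tmp => _ [theta ->].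
(* The bound [N <= phi j - k (phi j)] gives [N <= phi j], so [i] is a valid coordinate. *)
have close (e : R) j : 0 < e -> e < 1 -> (0 < phi j - k (phi j))%N ->
    (N <= phi j - k (phi j))%N ->
    [/\ C j \is a fin_num, E j \is a fin_num &
      `|fine (E j) - fine (C j)| <= coverage_error (phi j) (k (phi j)) e].
  move=> e0 e1 m0 mN; have n0 : (0 < phi j)%N := leq_trans m0 (leq_subr _ _).
  have [_ rk] := rX _ n0; have ikj := ik _ (leq_trans mN (leq_subr _ _)).
  have C1 := infC_le1 HZ rk ikj (eta0 (phi j)) (a0 (phi j)) s0.
  have [EC CE] :=
    infE_infC_close HZ rk ikj m0 (eta0 (phi j)) (a0 (phi j)) s0 e0 e1.
  have fC : C j \is a fin_num by rewrite ge0_fin_numE// (le_lt_trans C1)// ltry.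
  have fE : E j \is a fin_num.
    rewrite ge0_fin_numE//; apply: le_lt_trans EC _.
    by apply: lte_add_pinfty; [rewrite (le_lt_trans C1)// ltry|exact: ltry].
  split => //; move: EC CE; rewrite -/(E j) -/(C j) -(fineK fC) -(fineK fE).
  rewrite -!EFinD !lee_fin ler_norml => ? ?; apply/andP; split; lra.
apply/fine_cvgP; split.
  have [e [e0 e1 _]] := near_bound_small (@ltr01 R).
  near=> j.
  have m0 : (0 < phi j - k (phi j))%N by near: j; exact: phioo.
  have mN : (N <= phi j - k (phi j))%N by near: j; exact: phioo.
  have [fC fE _] := close e j e0 e1 m0 mN.
  by rewrite fin_numB -/(E j) -/(C j) fE fC.
apply/cvgrPdist_lt => eps eps0.
have eps4 : 0 < eps / 4 by rewrite divr_gt0.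
(* First [e] is fixed, making the [near_bound] term less than [eps / 2]; then a large [n - k] brings
   the Chernoff terms below [eps / 2] in total. *)
have [e [e0 e1 nbe]] := near_bound_small eps4.
have eps8 : 0 < eps / 8 by rewrite divr_gt0.
have he : -1 < e by lra.
have hNe : -1 < - e by lra.
have e00 : e != 0 by rewrite gt_eqF.
have Ne00 : - e != 0 by rewrite oppr_eq0.
have /cvgrPdist_lt/(_ _ eps8)[M1 _ HM1] := chernoff_base_cvg he e00.
have /cvgrPdist_lt/(_ _ eps8)[M2 _ HM2] := chernoff_base_cvg hNe Ne00.
near=> j.
have m0 : (0 < phi j - k (phi j))%N by near: j; exact: phioo.
have mN : (N <= phi j - k (phi j))%N by near: j; exact: phioo.
have mM1 : (M1 <= phi j - k (phi j))%N by near: j; exact: phioo.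
have mM2 : (M2 <= phi j - k (phi j))%N by near: j; exact: phioo.
have [fC fE H] := close e j e0 e1 m0 mN.
have := HM1 _ mM1; have := HM2 _ mM2.
rewrite /= !sub0r !normrN -/(E j) -/(C j) fineB//.
rewrite ![`|_ ^+ _|]ger0_norm ?exprn_ge0 ?sqrtr_ge0// => h2 h1.
apply: le_lt_trans H _; rewrite /coverage_error; lra.
Unshelve. all: by end_near.
Qed.
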